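(* Let $G$ be a group and let $A=\bigoplus_{t\in G}A_t$ and $B=\bigoplus_{t\in G}B_t$ be partially-strongly-graded algebras that are strongly-graded-equivalent. Then $A$ is strongly-graded if and only if $B$ is strongly-graded.
   Context: Algebras are associative, not necessarily unital, over a fixed commutative associative unital ring $k$; $G$ is an arbitrary group. Products of subsets such as $UV$ denote the $k$-span of all products $uv$. An algebra $A$ is idempotent if $A^2=A$. A $G$-graded algebra is $A=\bigoplus_{t\in G}A_t$ with $A_sA_t\subseteq A_{st}$. It is partially-strongly-graded if $A_t=A_tA_{t^{-1}}A_t$ for all $t\in G$, and strongly-graded if $A_rA_t=A_{rt}$ for all $r,t\in G$. Put $D^A_t:=A_tA_{t^{-1}}$, a two-sided ideal of $A_1$. (If $A$ is partially-strongly-graded, then $A$ and all $D^A_t$ are idempotent.) An $(R,S)$-bimodule $M$ is unital if $RM=M=MS$. A Morita context $(A,B,X,Y,\tau_A,\tau_B)$ consists of algebras $A,B$, an $(A,B)$-bimodule $X$, a $(B,A)$-bimodule $Y$, an $A$-bimodule map $\tau_A:X\otimes_BY\to A$ and a $B$-bimodule map $\tau_B:Y\otimes_AX\to B$ with $\tau_A(x\otimes y)x'=x\tau_B(y\otimes x')$ and $\tau_B(y\otimes x)y'=y\tau_A(x\otimes y')$. It is a graded Morita context between idempotent $G$-graded algebras $A,B$ if $X=\bigoplus_tX_t$, $Y=\bigoplus_tY_t$ are $G$-graded bimodules, and $\tau_A(X_r\otimes_B Y_s)\subseteq A_{rs}$, $\tau_B(Y_r\otimes_A X_s)\subseteq B_{rs}$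 for all $r,s\in G$. Suppose all $D^A_t$, $D^B_t$ are idempotent. A graded Morita context is strong if each $X_t$ is a unital $(D^A_t,D^B_{t^{-1}})$-bimodule and each $Y_t$ is a unital $(D^B_t,D^A_{t^{-1}})$-bimodule. The idempotent graded algebras $A$ and $B$ are strongly-graded-equivalent if there is a strong graded Morita context with $\tau_A,\tau_B$ surjective such that, for all $t\in G$, the $k$-span of $\{\tau_A(x\otimes y):x\in X_t,y\in Y_{t^{-1}}\}$ is $D^A_t$ and the $k$-span of $\{\tau_B(y\otimes x):y\in Y_t,x\in X_{t^{-1}}\}$ is $D^B_t$. *)

(* Defs.v *)
From HB Require Import structures.
From mathcomp Require Import all_boot all_algebra.
From mathcomp Require Import boolp classical_sets functions cardinality fsbigop.

Set Implicit Arguments.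
Unset Strict Implicit.
Unset Printing Implicit Defensive.

Import GRing.Theory.
Local Open Scope classical_set_scope.
Local Open Scope ring_scope.
Local Open Scope quotient_scope.

(* Associative algebras, not necessarily unital, over k. *)
Record algebra (k : comPzRingType) := Algebra {
  alg_sort :> lmodType k;
  amul : alg_sort -> alg_sort -> alg_sort;
  amul_linearl : forall b, linear (amul^~ b);
  amul_linearr : forall a, linear (amul a);
  amulA : associative amul
}.

(* The two actions are k-bilinear: the bimodules are central over k. No unital
   condition is imposed, since the algebras have no unit in general. *)
Record bimodule (k : comPzRingType) (R S : algebra k) := Bimodule {
  bimod_sort :> lmodType k;
  lact : R -> bimod_sort -> bimod_sort;
  ract : bimod_sort -> S -> bimod_sort;
  lact_linearl : forall x, linear (lact^~ x);
  lact_linearr : forall a, linear (lact a);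
  ract_linearl : forall b, linear (ract^~ b);
  ract_linearr : forall x, linear (ract x);
  lactA : forall a a' x, lact (amul a a') x = lact a (lact a' x);
  ractA : forall x b b', ract x (amul b b') = ract (ract x b) b';
  lactract : forall a x b, ract (lact a x) b = lact a (ract x b)
}.

Arguments amul {k a} : rename.
Arguments lact {k R S M} : rename.
Arguments ract {k R S M} : rename.

Record bimodule_map (k : comPzRingType) (R S : algebra k)
    (M N : bimodule R S) := BimoduleMap {
  bimap_fun :> {linear M -> N};
  bimap_lact : forall a x, bimap_fun (lact a x) = lact a (bimap_fun x);
  bimap_ract : forall x b, bimap_fun (ract x b) = ract (bimap_fun x) b
}.

Definition regular (k : comPzRingType) (A : algebra k) : bimodule A A :=
  {| bimod_sort := A; lact := @amul k A; ract := @amul k A;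
     lact_linearl := @amul_linearl k A; lact_linearr := @amul_linearr k A;
     ract_linearl := @amul_linearl k A; ract_linearr := @amul_linearr k A;
     lactA := fun a a' x => esym (amulA a a' x);
     ractA := fun x b b' => amulA x b b';
     lactract := fun a x b => esym (amulA a x b) |}.

(* The tensor product X (x)_B Y: formal sums of pairs (x, y), represented by
   sequences, modulo the congruence generated by the defining relations. The
   scalar c of a term c (x (x) y) is absorbed into x. *)
Section Tensor.
Variables (k : comPzRingType) (A B C : algebra k).
Variables (X : bimodule A B) (Y : bimodule B C).

Inductive tens_eq : seq (X * Y) -> seq (X * Y) -> Prop :=
| tens_refl s : tens_eq s s
| tens_sym s t : tens_eq s t -> tens_eq t s
| tens_trans t s u : tens_eq s t -> tens_eq t u -> tens_eq s u
| tens_cat s s' t t' : tens_eq s s' -> tens_eq t t' ->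
    tens_eq (s ++ t) (s' ++ t')
| tens_catC s t : tens_eq (s ++ t) (t ++ s)
| tens_0 y : tens_eq [:: (0, y)] [::]
| tens_Dl x x' y : tens_eq [:: (x + x', y)] [:: (x, y); (x', y)]
| tens_Dr x y y' : tens_eq [:: (x, y + y')] [:: (x, y); (x, y')]
| tens_Z c x y : tens_eq [:: (c *: x, y)] [:: (x, c *: y)]
| tens_bal x b y : tens_eq [:: (ract x b, y)] [:: (x, lact b y)].

Definition tens_rel : rel (seq (X * Y)) := fun s t => `[< tens_eq s t >].

Fact tens_rel_refl : reflexive tens_rel.
Proof. by move=> s; apply/asboolP; exact: tens_refl. Qed.

Fact tens_rel_sym : symmetric tens_rel.
Proof. by move=> s t; apply/asboolP/asboolP; exact: tens_sym. Qed.

Fact tens_rel_trans : transitive tens_rel.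
Proof. by move=> t s u /asboolP st /asboolP tu; apply/asboolP/(tens_trans st tu). Qed.

Canonical tens_equiv := EquivRel tens_rel tens_rel_refl tens_rel_sym tens_rel_trans.

Definition tensor_sort := {eq_quot tens_equiv}.
HB.instance Definition _ := Choice.on tensor_sort.
HB.instance Definition _ := Quotient.on tensor_sort.

Definition tclass (s : seq (X * Y)) : tensor_sort := \pi s.

Lemma tclassP s t : tclass s = tclass t <-> tens_eq s t.
Proof.
by split => [/eqmodP/asboolP//|st]; apply/eqmodP/asboolP.
Qed.

Lemma tclass_repr p : tclass (repr p) = p.
Proof. exact: reprK. Qed.

Lemma tens_repr s : tens_eq (repr (tclass s)) s.
Proof. by apply/tclassP; rewrite tclass_repr. Qed.

Lemma tclass_elim (P : tensor_sort -> Prop) : (forall s, P (tclass s)) -> forall p, P p.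
Proof. by move=> H p; rewrite -(tclass_repr p). Qed.

Definition tadd (p q : tensor_sort) : tensor_sort := tclass (repr p ++ repr q).

Lemma taddE s t : tadd (tclass s) (tclass t) = tclass (s ++ t).
Proof. by apply/tclassP; apply: tens_cat; exact: tens_repr. Qed.

Definition prodmap (u : X -> X) (v : Y -> Y) (z : X * Y) := (u z.1, v z.2).

Definition tmap u v (p : tensor_sort) : tensor_sort :=
  tclass (map (prodmap u v) (repr p)).

Lemma tmapE u v s :
  linear u -> linear v -> (forall x b, u (ract x b) = ract (u x) b) ->
  (forall b y, v (lact b y) = lact b (v y)) ->
  tmap u v (tclass s) = tclass (map (prodmap u v) s).
Proof.
move=> lu lv ub vb.
pose U := HB.pack_for {linear X -> X} u (GRing.isLinear.Build _ _ _ _ u lu).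
pose V := HB.pack_for {linear Y -> Y} v (GRing.isLinear.Build _ _ _ _ v lv).
have uE x : u x = U x by []; have vE y : v y = V y by [].
apply/tclassP; move: (tens_repr s); move: (repr _) => t; elim=> {s t}.
- by move=> s; exact: tens_refl.
- by move=> s t _; exact: tens_sym.
- by move=> t s w _ st _; exact: tens_trans st.
- by move=> *; rewrite !map_cat; exact: tens_cat.
- by move=> *; rewrite !map_cat; exact: tens_catC.
- by move=> y; rewrite /= /prodmap/= uE linear0; exact: tens_0.
- by move=> x x' y; rewrite /= /prodmap/= !uE linearD; exact: tens_Dl.
- by move=> x y y'; rewrite /= /prodmap/= !vE linearD; exact: tens_Dr.
- by move=> c x y; rewrite /= /prodmap/= !vE !uE !linearZ; exact: tens_Z.
- by move=> x b y; rewrite /= /prodmap/= ub vb; exact: tens_bal.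
Qed.

Lemma tclassD_map (f g h : X * Y -> X * Y) s :
  (forall z, tens_eq [:: h z] [:: f z; g z]) ->
  tclass (map h s) = tclass (map f s ++ map g s).
Proof.
move=> H; apply/tclassP; elim: s => [|z s IH]; first exact: tens_refl.
apply: (@tens_trans ([:: f z; g z] ++ (map f s ++ map g s))).
  exact: (tens_cat (H z) IH).
apply: (@tens_cat [:: f z] [:: f z]); first exact: tens_refl.
rewrite -[X in tens_eq _ X]/(map f s ++ g z :: map g s) -cat_rcons -cats1.
by apply: (@tens_cat (g z :: map f s)) (tens_refl _); exact: (tens_catC [:: g z]).
Qed.

Definition tscale (c : k) : tensor_sort -> tensor_sort := tmap ( *:%R c) id.

Fact scale_linear (V : lmodType k) (c : k) : linear ( *:%R c : V -> V).
Proof. by move=> a u v; rewrite scalerDr !scalerA mulrC. Qed.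

Fact id_linear (V : lmodType k) : linear (id : V -> V).
Proof. by []. Qed.

Fact scale_ract c (x : X) b : c *: ract x b = ract (c *: x) b.
Proof.
pose u : X -> X := fun x => ract x b.
pose U := HB.pack_for {linear X -> X} u
  (GRing.isLinear.Build _ _ _ _ u (ract_linearl b)).
by rewrite -[RHS]/(U (c *: x)) linearZ.
Qed.

Lemma tscaleE c s : tscale c (tclass s) = tclass (map (prodmap ( *:%R c) id) s).
Proof.
by apply: tmapE => //; [exact: scale_linear | exact: scale_ract].
Qed.

Fact taddA : associative tadd.
Proof.
by elim/tclass_elim => s; elim/tclass_elim => t; elim/tclass_elim => u;
  rewrite !taddE catA.
Qed.

Fact taddC : commutative tadd.
Proof.
elim/tclass_elim => s; elim/tclass_elim => t; rewrite !taddE.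
by apply/tclassP; exact: tens_catC.
Qed.

Fact tadd0 : left_id (tclass [::]) tadd.
Proof. by elim/tclass_elim => s; rewrite taddE. Qed.

Fact tscaleDl p c d : tscale (c + d) p = tadd (tscale c p) (tscale d p).
Proof.
elim/tclass_elim: p => s; rewrite !tscaleE taddE; apply: tclassD_map => z.
by rewrite /prodmap/= scalerDl; exact: tens_Dl.
Qed.

Fact tscale1 : left_id 1 tscale.
Proof.
elim/tclass_elim => s; rewrite tscaleE; congr tclass.
by rewrite map_id_in // => -[x y] _; rewrite /prodmap/= scale1r.
Qed.

Fact tscale0 p : tscale 0 p = tclass [::].
Proof.
elim/tclass_elim: p => s; rewrite tscaleE; apply/tclassP.
elim: s => [|z s IH] /=; first exact: tens_refl.
apply: (@tens_cat [:: _] [::] _ [::]) IH.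
by rewrite /prodmap/= scale0r; exact: tens_0.
Qed.

Fact taddN : left_inverse (tclass [::]) (tscale (-1)) tadd.
Proof. by move=> p; rewrite -{2}(tscale1 p) -tscaleDl addNr tscale0. Qed.

HB.instance Definition _ :=
  GRing.isZmodule.Build tensor_sort taddA taddC tadd0 taddN.

Fact tscaleA c d p : tscale c (tscale d p) = tscale (c * d) p.
Proof.
elim/tclass_elim: p => s; rewrite !tscaleE -map_comp; congr tclass.
by apply: eq_map => -[x y]; rewrite /prodmap/= scalerA.
Qed.

Fact tscaleDr : right_distributive tscale +%R.
Proof.
move=> c; elim/tclass_elim => s; elim/tclass_elim => t.
by rewrite [X in tscale c X = _]taddE !tscaleE [RHS]taddE map_cat.
Qed.

HB.instance Definition _ :=
  GRing.Zmodule_isLmodule.Build k tensor_sort tscaleA tscale1 tscaleDr tscaleDl.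

Definition tens (x : X) (y : Y) : tensor_sort := tclass [:: (x, y)].

Lemma tclassE s : tclass s = \sum_(z <- s) tens z.1 z.2.
Proof.
elim: s => [|[x y] s IH]; first by rewrite big_nil.
by rewrite big_cons -IH /tens [RHS]taddE.
Qed.

Lemma tmap_linear u v :
  linear u -> linear v -> (forall x b, u (ract x b) = ract (u x) b) ->
  (forall b y, v (lact b y) = lact b (v y)) -> linear (tmap u v).
Proof.
move=> lu lv ub vb c; elim/tclass_elim => s; elim/tclass_elim => t.
pose U := HB.pack_for {linear X -> X} u (GRing.isLinear.Build _ _ _ _ u lu).
rewrite [c *: (_ : tensor_sort)]tscaleE [X in tmap u v X]taddE !tmapE// [_ *: _]tscaleE [RHS]taddE.
rewrite map_cat -!map_comp; congr (tclass (_ ++ _)).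
by apply: eq_map => -[x y]; rewrite /prodmap/= -[u (_ *: _)]/(U _) linearZ.
Qed.

Definition tlact (a : A) : tensor_sort -> tensor_sort := tmap (lact a) id.
Definition tract (p : tensor_sort) (c : C) : tensor_sort := tmap id (ract^~ c) p.

Lemma tlactE a s : tlact a (tclass s) = tclass (map (prodmap (lact a) id) s).
Proof.
by apply: tmapE => //; [exact: lact_linearr | move=> *; rewrite lactract].
Qed.

Lemma tractE s c : tract (tclass s) c = tclass (map (prodmap id (ract^~ c)) s).
Proof.
by apply: tmapE => //; [exact: ract_linearl | move=> *; rewrite lactract].
Qed.

Fact tlact_linearl p : linear (tlact^~ p).
Proof.
elim/tclass_elim: p => s c a a'; rewrite /= !tlactE [_ *: tclass _]tscaleE [RHS]taddE.
rewrite -map_comp; apply: tclassD_map => z.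
by rewrite /prodmap/= lact_linearl; exact: tens_Dl.
Qed.

Fact tlact_linearr a : linear (tlact a).
Proof.
by apply: tmap_linear => //; [exact: lact_linearr | move=> *; rewrite lactract].
Qed.

Fact tract_linearl c : linear (tract^~ c).
Proof.
by apply: tmap_linear => //; [exact: ract_linearl | move=> *; rewrite lactract].
Qed.

Fact tract_linearr p : linear (tract p).
Proof.
elim/tclass_elim: p => s c b b'; rewrite /= !tractE [_ *: tclass _]tscaleE [RHS]taddE.
rewrite -map_comp; apply: tclassD_map => z.
rewrite /prodmap/= ract_linearr; apply: tens_trans (tens_Dr _ _ _) _.
apply: (@tens_cat [:: _] [:: _]); last exact: tens_refl.
by apply: tens_sym; exact: tens_Z.
Qed.

Fact tlactA a a' p : tlact (amul a a') p = tlact a (tlact a' p).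
Proof.
elim/tclass_elim: p => s; rewrite !tlactE -map_comp; congr tclass.
by apply: eq_map => -[x y]; rewrite /prodmap/= lactA.
Qed.

Fact tractA p c c' : tract p (amul c c') = tract (tract p c) c'.
Proof.
elim/tclass_elim: p => s; rewrite !tractE -map_comp; congr tclass.
by apply: eq_map => -[x y]; rewrite /prodmap/= ractA.
Qed.

Fact tlactract a p c : tract (tlact a p) c = tlact a (tract p c).
Proof.
by elim/tclass_elim: p => s; rewrite !(tlactE, tractE) -!map_comp; congr tclass.
Qed.

Definition tensor : bimodule A C := @Bimodule k A C tensor_sort tlact tract
  tlact_linearl tlact_linearr tract_linearl tract_linearr
  tlactA tractA tlactract.

Lemma lact_tens a x y : lact a (tens x y : tensor) = tens (lact a x) y.
Proof. exact: tlactE. Qed.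

Lemma ract_tens x y c : ract (tens x y : tensor) c = tens x (ract y c).
Proof. exact: tractE. Qed.

Lemma tens_linearl y : linear (tens^~ y).
Proof.
move=> c x x'; rewrite [c *: (_ : tensor_sort)]tscaleE [RHS]taddE.
by apply/tclassP; exact: tens_Dl.
Qed.

Lemma tens_linearr x : linear (tens x).
Proof.
move=> c y y'; rewrite [c *: (_ : tensor_sort)]tscaleE [RHS]taddE.
apply/tclassP; apply: tens_trans (tens_Dr _ _ _) _.
apply: (@tens_cat [:: _] [:: _]); last exact: tens_refl.
by apply: tens_sym; exact: tens_Z.
Qed.

Lemma tens_balanced x b y : tens (ract x b) y = tens x (lact b y).
Proof. by apply/tclassP; exact: tens_bal. Qed.

Lemma tensor_universal (Z : lmodType k) (f : X -> Y -> Z) :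
  (forall y, linear (f^~ y)) -> (forall x, linear (f x)) ->
  (forall x b y, f (ract x b) y = f x (lact b y)) ->
  exists! h : tensor -> Z, linear h /\ forall x y, h (tens x y) = f x y.
Proof.
move=> fl fr fb.
pose fL y := HB.pack_for {linear X -> Z} (f^~ y) (GRing.isLinear.Build _ _ _ _ (f^~ y) (fl y)).
pose fR x := HB.pack_for {linear Y -> Z} (f x) (GRing.isLinear.Build _ _ _ _ (f x) (fr x)).
have fLE x y : f x y = fL y x by []; have fRE x y : f x y = fR x y by [].
pose h (p : tensor) : Z := \sum_(z <- repr (p : tensor_sort)) f z.1 z.2.
have hE s : h (tclass s) = \sum_(z <- s) f z.1 z.2.
  rewrite /h; move: (tens_repr s); move: (repr _) => t; elim=> {s t}//=.
  - by move=> s t u _ -> _ ->.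
  - by move=> s s' t t' _ ss _ tt; rewrite !big_cat ss tt.
  - by move=> s t; rewrite !big_cat/= addrC.
  - by move=> y; rewrite big_seq1 big_nil/= fLE linear0.
  - by move=> x x' y; rewrite big_seq1 big_cons big_seq1/= !fLE linearD.
  - by move=> x y y'; rewrite big_seq1 big_cons big_seq1/= !fRE linearD.
  - by move=> c x y; rewrite !big_seq1/= fLE linearZ/= !fRE linearZ.
  - by move=> x b y; rewrite !big_seq1/= fb.
exists h; split; first split.
- move=> c; elim/tclass_elim => s; elim/tclass_elim => t.
  rewrite [c *: (_ : tensor_sort)]tscaleE [X in h X]taddE !hE big_cat/= big_map scaler_sumr.
  by congr (_ + _); apply: eq_bigr => -[x y] _ /=; rewrite !fLE linearZ.
- by move=> x y; rewrite hE big_seq1.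
move=> g [gl gE]; apply/funext; elim/tclass_elim => s; rewrite hE tclassE.
pose G := HB.pack_for {linear tensor -> Z} g (GRing.isLinear.Build _ _ _ _ g gl).
rewrite -[RHS]/(G (\sum_(z <- s) (tens z.1 z.2 : tensor))) linear_sum.
by apply: eq_bigr => -[x y] _; rewrite /= gE.
Qed.

End Tensor.

Section Spans.
Variable k : comPzRingType.

Definition kspan (V : lmodType k) (S : set V) : set V :=
  [set v | exists (n : nat) (c : 'I_n -> k) (u : 'I_n -> V),
    (forall i, S (u i)) /\ v = \sum_i c i *: u i].

(* UV for U a subset of an algebra or bimodule, V a subset of a bimodule or
   algebra, and m the corresponding multiplication or action *)
Definition sprod (U V W : lmodType k) (m : U -> V -> W)
    (S : set U) (T : set V) : set W :=
  kspan [set m u v | u in S & v in T].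

Definition is_submodule (V : lmodType k) (S : set V) : Prop :=
  S 0 /\ forall (c : k) (u v : V), S u -> S v -> S (c *: u + v).

Definition is_direct_sum (I : choiceType) (V : lmodType k)
    (V_ : I -> set V) : Prop :=
  (forall t, is_submodule (V_ t)) /\
  forall v, exists! f : I -> V,
    [/\ forall t, V_ t (f t), finite_set [set t | f t <> 0]
      & v = \sum_(t \in [set: I]) f t].

Definition idempotent_in (A : algebra k) (U : set A) : Prop :=
  sprod (@amul k A) U U = U.

(* For a subset U of a bimodule: RU = U = US *)
Definition unital_under (A B : algebra k) (M : bimodule A B)
    (R : set A) (U : set M) (S : set B) : Prop :=
  sprod (@lact k A B M) R U = U /\ sprod (@ract k A B M) U S = U.

End Spans.

Section Graded.
Variables (G : groupType) (k : comPzRingType).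

Record graded_algebra := GradedAlgebra {
  galg_sort :> algebra k;
  hcomp : G -> set galg_sort;
  hcomp_direct : is_direct_sum hcomp;
  hcomp_mul : forall s t,
    sprod (@amul k galg_sort) (hcomp s) (hcomp t) `<=` hcomp (s * t)%g
}.

Arguments hcomp : clear implicits.

Definition partially_strongly_graded (A : graded_algebra) : Prop :=
  forall t, hcomp A t =
    sprod (@amul k A) (sprod (@amul k A) (hcomp A t) (hcomp A t^-1%g))
      (hcomp A t).

Definition strongly_graded (A : graded_algebra) : Prop :=
  forall r t, sprod (@amul k A) (hcomp A r) (hcomp A t) = hcomp A (r * t)%g.

Definition Dideal (A : graded_algebra) (t : G) : set A :=
  sprod (@amul k A) (hcomp A t) (hcomp A t^-1%g).

Record graded_bimodule (A B : graded_algebra) := GradedBimodule {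
  gbimod_sort :> bimodule A B;
  bcomp : G -> set gbimod_sort;
  bcomp_direct : is_direct_sum bcomp;
  bcomp_lact : forall s t,
    sprod (@lact k A B gbimod_sort) (hcomp A s) (bcomp t) `<=` bcomp (s * t)%g;
  bcomp_ract : forall s t,
    sprod (@ract k A B gbimod_sort) (bcomp s) (hcomp B t) `<=` bcomp (s * t)%g
}.

End Graded.

Arguments hcomp {G k} A t _ : rename.
Arguments bcomp {G k A B} M t _ : rename.
Arguments Dideal {G k} A t _.

Record morita_context (k : comPzRingType) (A B : algebra k)
    (X : bimodule A B) (Y : bimodule B A) := MoritaContext {
  tauA : bimodule_map (tensor X Y) (regular A);
  tauB : bimodule_map (tensor Y X) (regular B);
  tauA_tauB : forall x y x',
    lact (tauA (tens x y) : A) x' = ract x (tauB (tens y x') : B);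
  tauB_tauA : forall y x y',
    lact (tauB (tens y x) : B) y' = ract y (tauA (tens x y') : A)
}.

Section GradedMorita.
Variables (G : groupType) (k : comPzRingType) (A B : graded_algebra G k).

(* X_r (x)_B Y_s, as a subset of X (x)_B Y, is the k-span of the tensors of
   elements of X_r and Y_s *)
Definition is_graded_context (X : graded_bimodule A B) (Y : graded_bimodule B A)
    (m : morita_context X Y) : Prop :=
  forall r s,
    tauA m @` sprod (@tens k A B A X Y) (bcomp X r) (bcomp Y s)
      `<=` hcomp A (r * s)%g /\
    tauB m @` sprod (@tens k B A B Y X) (bcomp Y r) (bcomp X s)
      `<=` hcomp B (r * s)%g.

Definition is_strong_context (X : graded_bimodule A B) (Y : graded_bimodule B A) :
    Prop :=
  forall t,
    unital_under (Dideal A t) (bcomp X t) (Dideal B t^-1%g) /\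
    unital_under (Dideal B t) (bcomp Y t) (Dideal A t^-1%g).

(* The first three conjuncts are the standing assumptions under which strong
   graded contexts are considered; they hold for partially strongly graded
   algebras. *)
Definition strongly_graded_equivalent : Prop :=
  [/\ idempotent_in [set: A],
      idempotent_in [set: B],
      forall t, idempotent_in (Dideal A t) /\ idempotent_in (Dideal B t)
    & exists (X : graded_bimodule A B) (Y : graded_bimodule B A)
        (m : morita_context X Y),
      [/\ is_graded_context m,
          is_strong_context X Y,
          (forall a : A, exists p, tauA m p = a) /\
          (forall b : B, exists p, tauB m p = b)
        & forall t,
            kspan [set (tauA m (tens x y) : A)
                  | x in bcomp X t & y in bcomp Y t^-1%g] = Dideal A t /\
            kspan [set (tauB m (tens y x) : B)
                  | y in bcomp Y t & x in bcomp X t^-1%g] = Dideal B t]].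

End GradedMorita.

(* Main.v *)
From HB Require Import structures.
Require Import Defs.
From mathcomp Require Import all_boot all_algebra.
From mathcomp Require Import classical_sets.

(** The point is that, for a partially strongly graded algebra [A], being
    strongly graded only means that every ideal [D_t = A_t A_{t^-1}] is all of
    [A_1]: if it is, then
      [A_{rt} = D_{rt} A_{rt} <= A_1 A_{rt} = A_r A_{r^-1} A_{rt} <= A_r A_t]
    (lemma [strongly_gradedP]). It then remains to carry this property of the
    ideals across a strong graded Morita context. If it holds for [A], then
    [Y_1 = Y_1 D^A_1], as the context is strong, while [D^A_1 <= A_1 <= D^A_t]
    is spanned by the values of [tauA] on [X_t] and [Y_{t^-1}]. By the
    compatibility of [tauA] and [tauB],
      [Y_1 <= Y_1 tauA(X_t, Y_{t^-1}) = tauB(Y_1, X_t) Y_{t^-1}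
           <= B_t Y_{t^-1}],
    and therefore
      [B_1 = D^B_1 = tauB(Y_1, X_1) <= B_t tauB(Y_{t^-1}, X_1)
           <= B_t B_{t^-1} = D^B_t]
    (lemma [strongly_graded_transfer]). The converse follows because exchanging
    the two halves of a Morita context shows that equivalence is symmetric. *)

Set Implicit Arguments.
Unset Strict Implicit.
Unset Printing Implicit Defensive.

Import GRing.Theory.
Local Open Scope classical_set_scope.
Local Open Scope ring_scope.

Section Spans.
Variable k : comPzRingType.
Implicit Types U V W : lmodType k.

Lemma kspan_min V (S T : set V) :
  is_submodule T -> S `<=` T -> kspan S `<=` T.
Proof.
move=> [T0 TD] ST _ [n [c [u [Su ->]]]].
apply: big_ind => //.
- by move=> v w Tv Tw; rewrite -(scale1r v); exact: TD.
- by move=> i _; rewrite -[_ *: _]addr0; apply: TD => //; exact/ST/Su.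
Qed.

Lemma sub_kspan V (S : set V) : S `<=` kspan S.
Proof.
move=> v Sv; exists 1%N, (fun=> 1), (fun=> v); split => //.
by rewrite big_ord1 scale1r.
Qed.

Lemma kspan_submodule V (S : set V) : is_submodule (kspan S).
Proof.
split=> [|a _ _ [n [c [u [Su ->]]]] [m [d [v [Sv ->]]]]].
  by exists 0%N, (fun=> 0), (fun=> 0); rewrite big_ord0; split=> // -[].
exists (n + m)%N.
exists (fun i => match split i with inl j => a * c j | inr j => d j end).
exists (fun i => match split i with inl j => u j | inr j => v j end).
split=> [i|]; first by case: (split i).
rewrite big_split_ord scaler_sumr; congr (_ + _); apply: eq_bigr => i _ /=.
- by rewrite (unsplitK (inl i)) scalerA.
- by rewrite (unsplitK (inr i)).
Qed.

Lemma preimage_submodule V W (f : V -> W) (T : set W) :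
  linear f -> is_submodule T -> is_submodule (f @^-1` T).
Proof.
move=> lf [T0 TD]; split=> [|c u v Tu Tv]; last by rewrite /preimage/= lf; exact: TD.
pose F := HB.pack_for {linear V -> W} f (GRing.isLinear.Build _ _ _ _ f lf).
by rewrite /preimage/= -[f 0]/(F 0) linear0.
Qed.

(** The form in which a claim about all elements of a span is reduced to its
    generators: the element may sit inside any linear expression [f]. *)
Lemma kspan_linear_sub V W (f : V -> W) (S : set V) (T : set W) :
  linear f -> is_submodule T -> (forall v, S v -> T (f v)) ->
  forall v, kspan S v -> T (f v).
Proof.
by move=> lf sT ST; apply: (kspan_min (preimage_submodule lf sT)) => v /ST.
Qed.

Lemma sprodM U V W (m : U -> V -> W) (S : set U) (T : set V) u v :
  S u -> T v -> sprod m S T (m u v).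
Proof. by move=> Su Tv; apply: sub_kspan; exists u => //; exists v. Qed.

Lemma linear_comp U V W (g : V -> W) (f : U -> V) :
  linear g -> linear f -> linear (g \o f).
Proof. by move=> lg lf c u v; rewrite /= lf lg. Qed.

End Spans.

Section StronglyGraded.
Variables (G : groupType) (k : comPzRingType).
Implicit Types (A B : graded_algebra G k) (t : G).

Lemma hcompM A r t (a b : A) :
  hcomp A r a -> hcomp A t b -> hcomp A (r * t)%g (amul a b).
Proof. by move=> Aa Ab; apply: hcomp_mul; exact: sprodM. Qed.

Lemma Dideal_sub1 A t : Dideal A t `<=` hcomp A 1%g.
Proof. by rewrite -(mulgV t); exact: hcomp_mul. Qed.

Lemma hcomp1_sub_Dideal1 A :
  partially_strongly_graded A -> hcomp A 1%g `<=` Dideal A 1%g.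
Proof.
move=> hA a; rewrite hA; apply: kspan_min; first exact: kspan_submodule.
move=> _ [d /Dideal_sub1 A1d [b A1b <-]].
by apply: sprodM; rewrite ?invg1.
Qed.

(** Cancelling [A_{r^-1}] against [A_{rt}] is what turns the single family of
    equations [A_r A_{r^-1} = A_1] into all the equations [A_r A_t = A_{rt}]. *)
Lemma strongly_gradedP A : partially_strongly_graded A ->
  strongly_graded A <-> forall t, hcomp A 1%g `<=` Dideal A t.
Proof.
move=> hA; split=> [sA t|A1D r t]; first by rewrite /Dideal sA mulgV.
apply/seteqP; split; first exact: hcomp_mul.
rewrite {1}hA; apply: kspan_min; first exact: kspan_submodule.
move=> _ [d /Dideal_sub1/(A1D r) Dd [a Aa <-]].
move: d Dd; apply: kspan_linear_sub.
- exact: amul_linearl.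
- exact: kspan_submodule.
move=> _ [u Au [v Av <-]]; rewrite -amulA; apply: sprodM => //.
by rewrite -[t](mulKg r); exact: hcompM.
Qed.

Lemma strongly_graded_equivalent_sym A B :
  strongly_graded_equivalent A B -> strongly_graded_equivalent B A.
Proof.
move=> [iA iB iD [X [Y [m [gm sm [surjA surjB] spanD]]]]].
split=> // [t|]; first by case: (iD t).
exists Y, X, (MoritaContext (tauB_tauA m) (tauA_tauB m)).
split=> [r s|t||t] //=.
- by case: (gm r s).
- by case: (sm t).
- by case: (spanD t).
Qed.

Lemma strongly_graded_transfer A B :
    partially_strongly_graded A -> partially_strongly_graded B ->
    strongly_graded_equivalent A B ->
  strongly_graded A -> strongly_graded B.
Proof.
move=> hA hB [_ _ _ [X [Y [m [gm sm _ spanD]]]]] /(strongly_gradedP hA) A1D.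
apply/(strongly_gradedP hB) => t b /(hcomp1_sub_Dideal1 hB).
have tauB_comp r s y x : bcomp Y r y -> bcomp X s x ->
    hcomp B (r * s)%g (tauB m (tens y x)).
  by move=> Yy Xx; apply: (gm r s).2; exists (tens y x) => //; exact: sprodM.
have tauB_lin x : linear (fun y => tauB m (tens y x) : B).
  apply: (@linear_comp _ _ (tensor Y X) _ _ (@tens _ _ _ _ Y X ^~ x)).
    by move=> c p q; rewrite linearP.
  exact: tens_linearl.
rewrite -(spanD 1%g).2; apply: kspan_min; first exact: kspan_submodule.
move=> _ [y Yy [x Xx <-]].
(* Y_1 = Y_1 D^A_1 because the context is strong. *)
move: y Yy; rewrite -(sm 1%g).2.2.
apply: kspan_linear_sub; first exact: tauB_lin.
  exact: kspan_submodule.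
move=> _ [y Yy [a /Dideal_sub1/(A1D t) Da <-]].
move: a Da; rewrite -(spanD t).1.
apply: kspan_linear_sub.
- exact: (linear_comp (tauB_lin x) (ract_linearr y)).
- exact: kspan_submodule.
move=> _ [x' Xx' [y' Yy' <-]].
rewrite -(tauB_tauA m) -lact_tens bimap_lact.
apply: sprodM.
- by rewrite -[t]mul1g; exact: tauB_comp.
- by rewrite -[t^-1%g]mulg1 -invg1; exact: tauB_comp.
Qed.

End StronglyGraded.

Theorem proposition4p9 (G : groupType) (k : comPzRingType)
    (A B : graded_algebra G k)
    (hA : partially_strongly_graded A) (hB : partially_strongly_graded B)
    (hAB : strongly_graded_equivalent A B) :
  strongly_graded A <-> strongly_graded B.
Proof.
split; first exact: strongly_graded_transfer.
exact: strongly_graded_transfer hB hA (strongly_graded_equivalent_sym hAB).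
Qed.
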